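(* There exist, for each $N$, complex numbers $\epsilon_k=\epsilon_k^{(N)}$ and $\rho_k=\rho_k^{(N)}$, $1\le k\le N$, such that: (1) for each $k$, the maps $f_k(z)=\frac{\rho_k z}{1-z}$ and $g_k(z)=\frac{z}{1-z}+\epsilon_k^2$ are conjugated; (2) $g_N\circ g_{N-1}\circ\cdots\circ g_1$ converges to the identity as $N\to\infty$, uniformly on compact subsets of $\mathbb{C}$; (3) for every $z\neq 0$, the composition $f_N\circ f_{N-1}\circ\cdots\circ f_1(z)$ does not converge to $z$ as $N\to\infty$.
   Context: The parameters $\epsilon_k,\rho_k$ may depend on $N$ as well as on $k$. All maps are regarded as Möbius transformations of the Riemann sphere; ''conjugated'' means analytically conjugated, i.e. there is a Möbius transformation $\varphi_k$ (which may depend on $k$ and $N$) with $g_k=\varphi_k\circ f_k\circ\varphi_k^{-1}$. *)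

(* Defs.v *)
From mathcomp Require Import all_boot all_order all_algebra.
From mathcomp Require Import complex.
From mathcomp Require Import all_classical all_reals all_analysis.
Set Implicit Arguments.
Unset Strict Implicit.
Unset Printing Implicit Defensive.
Import Order.TTheory GRing.Theory Num.Theory.
Import numFieldNormedType.Exports.
Local Open Scope classical_set_scope.
Local Open Scope ring_scope.
Local Open Scope complex_scope.

(* The regular module [R[i]^o] is the copy of [R[i]] that carries the topology
   of the modulus.  In the sphere, [Some z] is the finite point z and [None] is
   the point at infinity. *)
Notation sphere R := (one_point_compactification R[i]^o).

Section Maps.
Context {R : realType}.
Local Notation C := (R[i]).
Local Notation S := (sphere R).

Definition moebius (a b c d : C) (z : S) : S :=
  match z with
  | Some z => if c * z + d == 0 then None else Some ((a * z + b) / (c * z + d))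
  | None => if c == 0 then None else Some (a / c)
  end.

Definition is_moebius (h : S -> S) : Prop :=
  exists a b c d : C, a * d - b * c != 0 /\ h =1 moebius a b c d.

Definition conjugated (f g : S -> S) : Prop :=
  exists phi phi_inv : S -> S,
    [/\ is_moebius phi, cancel phi phi_inv, cancel phi_inv phi
      & g =1 phi \o f \o phi_inv].

(* For rho = 0 this map is not injective, hence not
   conjugated to any bijection of the sphere. *)
Definition f_map (rho : C) (z : S) : S :=
  match z with
  | Some z => if z == 1 then None else Some (rho * z / (1 - z))
  | None => Some (- rho)
  end.

Definition g_map (eps : C) (z : S) : S :=
  match z with
  | Some z => if z == 1 then None else Some (z / (1 - z) + eps ^+ 2)
  | None => Some (- 1 + eps ^+ 2)
  end.

(* The value h 0 is not used. *)
Fixpoint compose_upto (h : nat -> S -> S) (n : nat) : S -> S :=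
  if n is m.+1 then h m.+1 \o compose_upto h m else id.

(* The limit l is finite on compact subsets of the plane, so for each compact
   K the maps h n must eventually have no pole in K. *)
Definition cvg_unif_compacts (h : nat -> S -> S) (l : C -> C) : Prop :=
  forall K : set R[i]^o, compact K ->
  forall e : R, 0 < e ->
  \forall n \near \oo, forall z : C, K z ->
    exists2 w : C, h n (Some z) = Some w & `|w - l z| < e%:C.

End Maps.

(* Main.v *)
Require Import Defs.
From mathcomp Require Import all_boot all_order all_algebra.
From mathcomp Require Import complex.
From mathcomp Require Import all_classical all_reals all_analysis.
From mathcomp Require Import ring zify.
Import Order.TTheory GRing.Theory Num.Theory.
Import numFieldNormedType.Exports.
Local Open Scope classical_set_scope.
Local Open Scope ring_scope.
Local Open Scope complex_scope.

(** In the coordinate w = 1/z the map f_rho is the affine map (w - 1) / rho,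
    and f_rho is conjugated to g_eps as soon as rho = p^-2 and
    eps^2 = 2 + p + p^-1.  For p = i the map g_eps is an involution, and for p
    a primitive cube root of unity omega it has order 3; the choices omega and
    omega^2 give the same g_eps but inverse multipliers rho.  Hence, with an
    initial block of length 3 (N odd) or 6 (N even) using cube roots, followed
    by an even number of involutions, the g-composition is exactly the identity
    for N >= 6.  Alternating omega and omega^2 makes two successive f-maps a
    translation by omega^2 in the coordinate w, so for even N the f-composition
    is the translation by 3 omega^2, which moves every z <> 0. *)

Section Maps.
Context {R : realType}.
Local Notation C := (R[i]).
Local Notation S := (sphere R).
Implicit Types (p rho eps w : C) (z : S).

(** The conjugacy is the affine map z -> 1 - p (z - 1). It fixes infinity and the common pole 1;
    matching residues at 1 gives [rho = p ^- 2], and matching the images of infinity gives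
    [eps ^+ 2]. *)
Lemma f_g_conjugated p rho eps : p != 0 -> rho = p ^- 2 ->
  eps ^+ 2 = 2 + p + p^-1 -> conjugated (f_map rho) (g_map eps).
Proof.
move=> p0 rhoE epsE.
exists (moebius (- p) (1 + p) 0 1), (moebius (- p^-1) (1 + p^-1) 0 1).
have affE (a b x : C) : moebius a b 0 1 (Some x) = Some (a * x + b).
  by rewrite /= mul0r add0r oner_eq0 divr1.
have affN (a b : C) : moebius a b 0 1 None = None by rewrite /= eqxx.
split.
- exists (- p), (1 + p), 0, 1; split => //.
  by rewrite mulr0 subr0 mulr1 oppr_eq0.
- by case=> [x|]; rewrite ?affE ?affN //; congr Some; field.
- by case=> [x|]; rewrite ?affE ?affN //; congr Some; field.
- case=> [x|]; rewrite [in RHS]/comp ?affE ?affN; last first.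
    by rewrite [f_map _ _]/= affE /= epsE rhoE; congr Some; field.
  set y := - p^-1 * x + _.
  have y1 : (y == 1) = (x == 1).
    rewrite -subr_eq0 -[x == 1]subr_eq0.
    have -> : y - 1 = - p^-1 * (x - 1) by rewrite /y; ring.
    by rewrite mulf_eq0 oppr_eq0 invr_eq0 (negbTE p0).
  rewrite /f_map /g_map y1; have [//|x1] := eqVneq x 1.
  rewrite affE epsE rhoE /y; congr Some; field.
  have -> : p - (-1 * x + (p + 1)) = x - 1 by ring.
  by rewrite p0 !subr_eq0 [1 == x]eq_sym x1.
Qed.

(** As a matrix of determinant 1, g has trace 2 - eps^2, which vanishes here. Concretely 1 - g(x) =
    -1 / (1 - x). *)
Lemma g_map_order2 eps : eps ^+ 2 = 2 -> involutive (g_map eps).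
Proof.
move=> epsE [x|] /=; rewrite epsE; last first.
  have -> : -1 + 2 = 1 :> C by ring.
  by rewrite eqxx.
have [->|x1] := eqVneq x 1 => /=; rewrite epsE.
  by congr Some; ring.
have x1' : 1 - x != 0 by rewrite subr_eq0 eq_sym.
have E : x / (1 - x) + 2 = 1 + (1 - x)^-1 by field.
rewrite E -subr_eq0 addrAC subrr add0r invr_eq0 (negbTE x1').
congr Some; field; rewrite x1' /=.
by rewrite (_ : _ - _ = -1) ?oppr_eq0 ?oner_eq0 //; ring.
Qed.

(** Here the trace is 1 and g is x -> 1 / (1 - x). The cycle 0, 1, infinity is treated apart, as
    poles occur only there. *)
Lemma g_map_order3 eps z : eps ^+ 2 = 1 -> iter 3 (g_map eps) z = z.
Proof.
move=> epsE.
have gE (x : C) : x != 1 -> g_map eps (Some x) = Some (1 - x)^-1.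
  move=> x1; rewrite /= (negbTE x1) epsE; congr Some.
  by field; rewrite subr_eq0 eq_sym.
have g1 : g_map eps (Some 1) = None by rewrite /= eqxx.
have gN : g_map eps None = Some 0 by rewrite /= epsE addNr.
have g0 : g_map eps (Some 0) = Some 1.
  by rewrite gE ?subr0 ?invr1 // eq_sym oner_eq0.
rewrite !iterS; case: z => [x|]; last by rewrite gN g0 g1.
have [->|x1] := eqVneq x 1; first by rewrite g1 gN g0.
have [->|x0] := eqVneq x 0; first by rewrite g0 g1 gN.
have x1' : 1 - x != 0 by rewrite subr_eq0 eq_sym.
have E : 1 - (1 - x)^-1 = - x / (1 - x) by field.
have E2 : 1 - - (1 - x) / x = x^-1 by field.
have E3 : (- x / (1 - x))^-1 = - (1 - x) / x by rewrite invf_div invrN mulrN mulNr.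
rewrite gE // gE; last first.
  by rewrite eq_sym -subr_eq0 E mulf_neq0 ?invr_eq0 ?oppr_eq0.
rewrite E E3 gE ?E2 ?invrK //.
by rewrite eq_sym -subr_eq0 E2 invr_eq0.
Qed.

(* The point of the sphere whose coordinate 1/z is w. *)
Definition recip w : S := if w == 0 then None else Some w^-1.

Lemma recip_inj : injective recip.
Proof.
move=> v w; rewrite /recip.
by case: eqP => [->|_]; case: eqP => [->|_] // -[] /invr_inj.
Qed.

Lemma recip_surj z : z <> Some 0 -> exists w, z = recip w.
Proof.
case: z => [x|] z0; last by exists 0; rewrite /recip eqxx.
exists x^-1; rewrite /recip invr_eq0 invrK; case: eqP => // x0.
by case: z0; rewrite x0.
Qed.

Lemma f_map_recip rho w : rho != 0 ->
  f_map rho (recip w) = recip ((w - 1) / rho).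
Proof.
move=> rho0; rewrite /recip mulf_eq0 invr_eq0 (negbTE rho0) orbF subr_eq0.
have [->|w0] := eqVneq w 0.
  rewrite eq_sym oner_eq0 /=; congr Some.
  by rewrite sub0r mulN1r invrN invrK.
rewrite /= -[w^-1 == 1]invr_eq1 invrK.
have [//|w1] := eqVneq w 1; congr Some; field.
by rewrite rho0 w0 subr_eq0 w1.
Qed.

(** The maps after index [m] cancel in consecutive pairs. This serves both for the g-maps and for
    the f-maps. *)
Lemma compose_upto_involutions (h : nat -> S -> S) m j z :
    (forall i, (m < i)%N ->
       h i.+1 (h i (compose_upto h m z)) = compose_upto h m z) ->
  compose_upto h (m + j.*2) z = compose_upto h m z.
Proof.
move=> hh; elim: j => [|j IHj]; first by rewrite addn0.
by rewrite doubleS !addnS /= IHj hh // ltnS leq_addr.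
Qed.

(** Points of the sphere are closed, so if z and z' differ, the sequence eventually stays in the
    complement of z'. *)
Lemma eq_of_cvg_frequently (u : nat -> S) z z' :
  u @ \oo --> z -> (forall n, exists2 m, (n <= m)%N & u m = z') -> z = z'.
Proof.
move=> uz uz'; apply: contrapT => zz'.
suff : nbhs z [set x | x <> z'].
  move=> /uz [n _ nu]; have [m nm um] := uz' n.
  by have := nu m nm; rewrite /= um.
case: z zz' {uz} => [x|]; case: z' {uz'} => [y|] // xy.
- suff : nbhs (x : R[i]^o) [set t | t <> y].
    by apply: filterS => t ty [].
  apply: open_nbhs_nbhs; split; last by move=> /= xyE; apply: xy; rewrite xyE.
  exact/closed_openC/accessible_closed_set1/hausdorff_accessible/norm_hausdorff.
- suff : nbhs (x : R[i]^o) setT by apply: filterS.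
  exact: filterT.
(* At infinity, the neighbourhood is the complement of the closed compact set {y}. *)
- exists [set y]; last by move=> t [[a ya <-] [] //|->].
  split; first exact: compact_set1.
  exact/accessible_closed_set1/hausdorff_accessible/norm_hausdorff.
Qed.

End Maps.

Theorem theorem3 (R : realType) :
  exists eps rho : nat -> nat -> R[i],
  [/\ (forall N k : nat, (1 <= k <= N)%N ->
         conjugated (f_map (rho N k)) (g_map (eps N k))),
      cvg_unif_compacts
        (fun N => compose_upto (fun k => g_map (eps N k)) N) id
    & forall z : sphere R, z <> Some 0 ->
        ~ ((fun N => compose_upto (fun k => f_map (rho N k)) N z) @ \oo --> z)].
Proof.
pose om : R[i] := (-1 + sqrtC (- 3)) / 2.
have omE : om ^+ 2 + om + 1 = 0.
  have -> : om ^+ 2 + om + 1 = (sqrtC (- 3) ^+ 2 + 3) / 4 by rewrite /om; field.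
  by rewrite sqrtCK addNr mul0r.
have om0 : om != 0.
  apply: contra_eq_neq omE => ->.
  by rewrite expr0n /= !add0r oner_eq0.
have om3 : om ^+ 3 = 1.
  apply/eqP; rewrite -subr_eq0; apply/eqP.
  have -> : om ^+ 3 - 1 = (om - 1) * (om ^+ 2 + om + 1) by ring.
  by rewrite omE mulr0.
have omV : om^-1 = om ^+ 2.
  by apply: (mulfI om0); rewrite divff // -exprS om3.
(* [T N] is a multiple of 3, to suit the order of g on the block, and has the parity of N, so that
   an even number of maps remains. *)
pose T (N : nat) := (if odd N then 3 else 6)%N.
pose p (N k : nat) : R[i] :=
  if (k <= T N)%N then (if odd k then om else om ^+ 2) else 'i.
have p0 N k : p N k != 0.
  by rewrite /p; case: ifP => _; [case: ifP => _|]; rewrite ?expf_neq0 ?neq0Ci.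
pose eps N k := sqrtC (2 + p N k + (p N k)^-1).
pose rho N k := p N k ^- 2.
have epsE1 N k : (k <= T N)%N -> eps N k ^+ 2 = 1.
  move=> kT; rewrite sqrtCK /p kT; case: ifP => _; rewrite ?exprVn ?omV.
    by rewrite -[RHS]addr0 -omE; ring.
  by rewrite -omV invrK omV -[RHS]addr0 -omE; ring.
have epsE2 N k : (T N < k)%N -> eps N k ^+ 2 = 2.
  by rewrite ltnNge => /negbTE kT; rewrite sqrtCK /p kT invCi addrK.
have TE N : (6 <= N)%N -> exists j, N = (T N + j.*2)%N.
  move=> N6; rewrite /T; exists ((N - T N)./2); rewrite /T; case: ifP; lia.
exists eps, rho; split.
- by move=> N k _; apply: (@f_g_conjugated _ (p N k)); rewrite ?sqrtCK.
- move=> K _ e e0; exists 6 => // N N6 x _; exists x; last first.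
    by rewrite subrr normr0 ltcR.
  have [j jE] := TE N N6.
  pose h k := g_map (eps N k).
  have h3 k z : (k.+3 <= T N)%N -> h k.+3 (h k.+2 (h k.+1 z)) = z.
    move=> kT.
    (* g depends on eps only through its square, so the root chosen by [sqrtC] is immaterial. *)
    have hE i : (i <= k.+3)%N -> h i =1 g_map 1.
      move=> ik y; rewrite /h /g_map epsE1 ?expr1n //.
      exact: leq_trans kT.
    rewrite !hE; [|lia..]; exact: (@g_map_order3 _ 1 z (expr1n _ _)).
  change (compose_upto h N (Some x) = Some x); rewrite jE.
  have hT : compose_upto h (T N) (Some x) = Some x.
    move: h3; rewrite /T; case: (odd N) => h3; first exact: (h3 0%N).
    exact: etrans (h3 3%N _ isT) (h3 0%N _ isT).
  rewrite compose_upto_involutions hT // => i iT.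
  have -> : h i.+1 =1 h i by move=> y; rewrite /h /g_map !epsE2 // ltnS ltnW.
  exact/g_map_order2/epsE2.
move=> z /recip_surj[w ->] cz.
have rho0 N k : rho N k != 0 by rewrite invr_eq0 expf_neq0.
suff : recip w = recip (w + 3 * om ^+ 2).
  move=> /recip_inj/eqP; rewrite -subr_eq0 opprD addNKr oppr_eq0 mulf_eq0.
  by rewrite pnatr_eq0 expf_eq0 (negbTE om0).
apply: eq_of_cvg_frequently cz _ => n.
exists (6 + n.*2)%N; first by lia.
set N := (6 + n.*2)%N.
have TN : T N = 6%N by rewrite /T /N oddD odd_double.
(* Since p^3 = 1 on the block, p^-2 = p there; beyond it, 'i^-2 = -1. *)
have rE k : rho N k = if (k <= 6)%N then if odd k then om else om ^+ 2 else -1.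
  rewrite /rho /p TN; case: ifP => _; last by rewrite sqrCi invrN1.
  case: ifP => _; first by rewrite -exprVn omV -exprM (exprD _ 3 1) om3 mul1r.
  by rewrite -exprVn -omV invrK.
pose h k := f_map (rho N k).
have hE k v : h k (recip v) = recip ((v - 1) / rho N k) by rewrite /h f_map_recip.
have h6 : compose_upto h 6 (recip w) = recip (w + 3 * om ^+ 2).
  rewrite /= !hE !rE /=; congr recip.
  have -> : (om ^+ 2)^-1 = om by rewrite -omV invrK.
  (* The multipliers cancel, leaving the translation by -1 - om = om^2. *)
  have om2 v : ((v - 1) * om ^+ 2 - 1) * om = v + om ^+ 2.
    transitivity (v * om ^+ 3 - om ^+ 3 - om); first by ring.
    by rewrite om3 mulr1 -[RHS]subr0 -omE; ring.
  by rewrite omV !om2; ring.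
change (compose_upto h N (recip w) = recip (w + 3 * om ^+ 2)).
rewrite compose_upto_involutions h6 // => i i6.
have [iF iF'] : (i < 6)%N = false /\ (i <= 6)%N = false by lia.
(* With multiplier -1, each f-map is the involution w -> 1 - w. *)
by rewrite !hE !rE iF iF'; congr recip; field.
Qed.
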